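(* Let $N=IJK$ with $I,J,K$ positive integers, let $\lambda>0$, and let $\mathbf{B}\in\mathbb{R}^{N\times R}$ be a matrix of full column rank all of whose columns have Euclidean norm one. Suppose that $$\mathbf{b}=\mathbf{B}\bm{\theta}^*+\bm{\varepsilon},$$ where $\bm{\theta}^*\in\mathbb{R}^R$ has exactly $k<R$ nonzero entries, with index set $S$ (so, after reordering, $\bm{\theta}^*=({\bm{\theta}_S^*}^T,\mathbf{0}^T)^T$), and $\bm{\varepsilon}\in\mathbb{R}^N$ is a random vector with independent subgaussian entries of mean zero and parameter $\sigma^2$. Suppose there exist $\gamma$ and $\mu$ with $0<\gamma<1$ and $\mu>0$ such that $$\|\mathbf{B}_{S^C}^T\mathbf{B}_S(\mathbf{B}_S^T\mathbf{B}_S)^{-1}\|_{\infty}\leq 1-\gamma\quad\text{and}\quad\lambda_{\min}(\mathbf{B}_S^T\mathbf{B}_S)\geq\mu.$$ Let $\bm{\hat{\theta}}$ be the optimal solution of $\min_{\bm{\theta}\in\mathbb{R}^R}\frac{1}{2}\|\mathbf{b}-\mathbf{B}\bm{\theta}\|_2^2+\lambda\|\bm{\theta}\|_1$, let $\hat{S}$ be the index set of nonzero entries of $\bm{\hat{\theta}}$, let $\bm{\hat{\theta}}_S\in\mathbb{R}^{k}$ denote the optimal solution of the restricted problem $\min_{\bm{\theta}_S\in\mathbb{R}^{k}}\frac{1}{2}\|\mathbf{b}-\mathbf{B}_S\bm{\theta}_S\|_2^2+\lambda\|\bm{\theta}_S\|_1$, and let $\bm{\delta}_S=\bm{\hat{\theta}}_S-\bm{\theta}_S^*$.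 Then $$Pr\Big(\{\hat{S}\subseteq S\}\cap\Big\{\|\bm{\delta}_S\|_{\infty}\leq\frac{\lambda}{2\sqrt{\mu}}+\lambda\|(\mathbf{B}_S^T\mathbf{B}_S)^{-1}\|_{\infty}\Big\}\Big)\geq 1-2R\exp\Big(-\frac{\lambda^2\gamma^2}{8\sigma^2}\Big).$$ Furthermore, if the lower bound of the absolute values of the elements of $\bm{\theta}_S^*$ is larger than $\lambda\big(\frac{1}{2\sqrt{\mu}}+\|(\mathbf{B}_S^T\mathbf{B}_S)^{-1}\|_{\infty}\big)$, then $$Pr(\{\hat{S}=S\})\geq 1-2R\exp\Big(-\frac{\lambda^2\gamma^2}{8\sigma^2}\Big).$$
   Context: $S^C$ is the complement of $S$ in $\{1,\dots,R\}$; $\mathbf{B}_S$ and $\mathbf{B}_{S^C}$ are the submatrices of $\mathbf{B}$ formed by the columns indexed by $S$ and $S^C$; $\bm{\theta}^*_S$ is the subvector of $\bm{\theta}^*$ indexed by $S$. For a matrix $M$, $\|M\|_\infty=\max_i\sum_j|M_{ij}|$; for a vector, $\|\cdot\|_\infty$ is the maximum absolute value of the entries. $\lambda_{\min}$ denotes the smallest eigenvalue. A mean-zero random variable $\xi$ is subgaussian with parameter $\sigma^2>0$ if $\mathbb{E}\,e^{t\xi}\le e^{\sigma^2t^2/2}$ for all $t\in\mathbb{R}$. The matrix $\mathbf{B}$ is a fixed (nonrandom) design matrix. Since $\mathbf{B}$ has full column rank, both optimization problems have unique solutions. (In the application to tensors, $\mathbf{b}$ is the vectorization of a tensor in $\mathbb{R}^{I\times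 J\times K}$ and the columns of $\mathbf{B}$ are vectorizations of rank-one tensors $\mathbf{x}_r\circ\mathbf{y}_r\circ\mathbf{z}_r$ with unit-norm factors.) *)

(* Defs.v *)
From HB Require Import structures.
From mathcomp Require Import all_boot all_order all_algebra.
From mathcomp Require Import all_classical all_reals all_analysis.

Set Implicit Arguments.
Unset Strict Implicit.
Unset Printing Implicit Defensive.

Import Order.TTheory GRing.Theory Num.Theory.
Import numFieldNormedType.Exports.

Local Open Scope ring_scope.

Definition l1norm (R : realType) (n : nat) (v : 'cV[R]_n) : R :=
  \sum_i `|v i 0|.

Definition l2norm (R : realType) (n : nat) (v : 'cV[R]_n) : R :=
  Num.sqrt (\sum_i v i 0 ^+ 2).

(* Maximum absolute row sum.  This is not the library norm `|M| of a matrix,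
   which is the maximum of the absolute values of the entries: `|v| is the sup
   norm of a column vector v and is used as such below. *)
Definition opnorm_inf (R : realType) (m n : nat) (M : 'M[R]_(m, n)) : R :=
  \big[Num.max/0]_(i < m) \sum_(j < n) `|M i j|.

(* The infimum is taken in the extended reals, so that it is +oo for the 0 x 0
   matrix; for a symmetric matrix of positive size it is a minimum. *)
Definition lambda_min (R : realType) (n : nat) (M : 'M[R]_n) : \bar R :=
  ereal_inf [set a%:E | a in [set a : R | eigenvalue M a]%classic]%classic.

Definition vsupp (R : realType) (n : nat) (v : 'cV[R]_n) : {set 'I_n} :=
  finset (fun j => v j 0 != 0).

(* Coordinates in S are renumbered increasingly by 'I_#|S|. *)
Definition cols (R : realType) (m n : nat) (S : {set 'I_n})
    (B : 'M[R]_(m, n)) : 'M[R]_(m, #|S|) :=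
  colsub (fun i : 'I_#|S| => enum_val i) B.

Definition subvec (R : realType) (n : nat) (S : {set 'I_n})
    (v : 'cV[R]_n) : 'cV[R]_#|S| :=
  rowsub (fun i : 'I_#|S| => enum_val i) v.

Definition lasso_obj (R : realType) (m n : nat) (b : 'cV[R]_m)
    (B : 'M[R]_(m, n)) (lam : R) (theta : 'cV[R]_n) : R :=
  2^-1 * l2norm (b - B *m theta) ^+ 2 + lam * l1norm theta.

Definition lasso_solution (R : realType) (m n : nat) (b : 'cV[R]_m)
    (B : 'M[R]_(m, n)) (lam : R) (theta : 'cV[R]_n) : Prop :=
  forall theta' : 'cV[R]_n,
    lasso_obj b B lam theta <= lasso_obj b B lam theta'.

Definition independent_rvs (d : measure_display) (T : measurableType d)
    (R : realType) (P : probability T R) (I : finType)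
    (X : I -> {RV P >-> R}) : Prop :=
  forall (J : {set I}) (A : I -> set R),
    (forall i, measurable (A i)) ->
    P [set w | forall i, i \in J -> A i (X i w)]%classic =
    (\prod_(i in J) P (X i @^-1` A i)%classic)%E.

Definition subgaussian (d : measure_display) (T : measurableType d)
    (R : realType) (P : probability T R) (X : {RV P >-> R}) (s2 : R) : Prop :=
  [/\ (P.-integrable [set: T] (EFin \o X))%classic,
      ('E_P[X] = 0)%E
    & forall t : R, ('M_P X t <= (expR (s2 * t ^+ 2 / 2))%:E)%E].

(* Main.v *)
(* Primal-dual witness argument.  With A = B_S, G = A^T A and W = G^-1 A^T, the
   optimality condition of the restricted problem reads
     delta_S = W eps - G^-1 c,  |c|_oo <= lam,
   and the residual correlation of a column B_j, j outside S, is
     B_j^T (1 - A W) eps + B_j^T A G^-1 c,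
   whose second term is at most lam (1 - gamma) by incoherence.  So as soon as
   |W eps|_oo <= lam / (2 sqrt mu) and |B_j^T (1 - A W) eps| <= lam gamma for all
   such j, the error bound holds and the zero extension of the restricted
   solution is optimal for the full problem, hence equal to its unique solution.
   These are r bounds on linear combinations of the noise whose coefficient
   vectors have squared norm at most 1 / mu (diagonal of G^-1, spectral theorem)
   and at most 1 (1 - A W is an orthogonal projection): a Chernoff bound on each
   and a union bound give the probability.  The events are measurable because
   the solutions depend on b in a Lipschitz way. *)

Require Import Defs.
From HB Require Import structures.
From mathcomp Require Import all_boot all_order all_algebra.
From mathcomp Require Import spectral sesquilinear complex finmap.
From mathcomp Require Import all_classical all_reals all_analysis.
From mathcomp Require Import measurable_realfun.
From mathcomp Require Import ring lra.

Set Implicit Arguments.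
Unset Strict Implicit.
Unset Printing Implicit Defensive.

Import Order.TTheory GRing.Theory Num.Theory.
Import numFieldNormedType.Exports.

Local Open Scope classical_set_scope.
Local Open Scope ring_scope.

(** * Optimality conditions and stability of the lasso *)

Section vdot.
Variable R : realType.

Definition vdot n (u v : 'cV[R]_n) : R := \sum_i u i 0 * v i 0.

Lemma vdotC n (u v : 'cV[R]_n) : vdot u v = vdot v u.
Proof. by apply: eq_bigr => i _; rewrite mulrC. Qed.

Lemma vdotDr n (u v w : 'cV[R]_n) : vdot u (v + w) = vdot u v + vdot u w.
Proof. by rewrite -big_split; apply: eq_bigr => i _; rewrite mxE mulrDr. Qed.

Lemma vdotZr n a (u v : 'cV[R]_n) : vdot u (a *: v) = a * vdot u v.
Proof. by rewrite mulr_sumr; apply: eq_bigr => i _; rewrite mxE mulrCA. Qed.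

Lemma vdotNr n (u v : 'cV[R]_n) : vdot u (- v) = - vdot u v.
Proof. by rewrite -scaleN1r vdotZr mulN1r. Qed.

Lemma vdotBr n (u v w : 'cV[R]_n) : vdot u (v - w) = vdot u v - vdot u w.
Proof. by rewrite vdotDr vdotNr. Qed.

Lemma vdotBl n (u v w : 'cV[R]_n) : vdot (v - w) u = vdot v u - vdot w u.
Proof. by rewrite vdotC vdotBr !(vdotC u). Qed.

Lemma vdotE n (u v : 'cV[R]_n) : vdot u v = (u^T *m v) 0 0.
Proof. by rewrite mxE; apply: eq_bigr => i _; rewrite mxE. Qed.

Lemma vdot_mulmx m n (A : 'M[R]_(m, n)) u v :
  vdot (A *m u) v = vdot u (A^T *m v).
Proof. by rewrite !vdotE trmx_mul mulmxA. Qed.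

Lemma vdot_delta n (u : 'cV[R]_n) j : vdot u (delta_mx j 0) = u j 0.
Proof.
rewrite /vdot (bigD1 j)//= big1 ?addr0 => [|i /negPf ij].
  by rewrite mxE !eqxx mulr1.
by rewrite mxE ij mulr0.
Qed.

Lemma vdot_ge0 n (u : 'cV[R]_n) : 0 <= vdot u u.
Proof. by apply: sumr_ge0 => i _; rewrite -expr2 sqr_ge0. Qed.

Lemma l2norm_sqr n (v : 'cV[R]_n) : l2norm v ^+ 2 = vdot v v.
Proof.
rewrite sqr_sqrtr; last by rewrite sumr_ge0// => i _; exact: sqr_ge0.
by apply: eq_bigr => i _; rewrite expr2.
Qed.

Lemma l1normD n (u v : 'cV[R]_n) : l1norm (u + v) <= l1norm u + l1norm v.
Proof.
by rewrite /l1norm -big_split ler_sum// => i _; rewrite mxE ler_normD.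
Qed.

Lemma l1normZ n (a : R) (v : 'cV[R]_n) : l1norm (a *: v) = `|a| * l1norm v.
Proof. by rewrite /l1norm mulr_sumr; apply: eq_bigr => i _; rewrite mxE normrM. Qed.

Lemma l1norm_delta n (j : 'I_n) : l1norm (delta_mx j 0 : 'cV[R]_n) = 1.
Proof.
rewrite /l1norm (bigD1 j)//= big1 ?addr0 => [|i /negPf ij].
  by rewrite mxE !eqxx normr1.
by rewrite mxE ij normr0.
Qed.

End vdot.

Section lasso.
Variables (R : realType) (m n : nat) (B : 'M[R]_(m, n)) (lam : R).
Implicit Types (b : 'cV[R]_m) (th v : 'cV[R]_n).

Definition lasso_corr b th : 'cV[R]_n := B^T *m (b - B *m th).

(** The quadratic part expands exactly around [th], so both directions of the optimality condition
    can be read off this identity. *)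
Lemma lasso_objB b th v :
  lasso_obj b B lam v - lasso_obj b B lam th =
  2^-1 * vdot (B *m (v - th)) (B *m (v - th)) - vdot (lasso_corr b th) (v - th)
  + lam * (l1norm v - l1norm th).
Proof.
rewrite /lasso_obj !l2norm_sqr /lasso_corr vdotC -vdot_mulmx.
set r := b - B *m th; set y := B *m (v - th).
have -> : b - B *m v = r - y.
  by rewrite /r /y mulmxBr opprB addrA addrNK.
clearbody r y; rewrite !(vdotBr, vdotBl) (vdotC y r).
by field.
Qed.

(* [lasso_corr b th] is minus the gradient at [th] of the smooth part of the
   objective, so the right-hand side is the first-order optimality condition. *)
Lemma lasso_solutionP b th : 0 <= lam ->
  lasso_solution b B lam th <->
  forall v, vdot (lasso_corr b th) (v - th) <= lam * (l1norm v - l1norm th).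
Proof.
move=> lam_ge0; split=> [opt v|vi v]; last first.
  rewrite -subr_ge0 lasso_objB.
  have := vi v; have := vdot_ge0 (B *m (v - th)); lra.
set c := vdot _ _; set D := lam * _; set a := 2^-1 * vdot (B *m (v - th)) (B *m (v - th)).
have a_ge0 : 0 <= a by rewrite mulr_ge0 ?invr_ge0 ?vdot_ge0.
rewrite leNgt; apply/negP => Dc.
(* If [D < c], moving by the fraction [s] towards [v] changes the objective by at most s^2 a - s (c
   - D), by convexity of the l1 norm. This [s] lies in ]0, 1] even when [a] is 0, and turns the
   bound into - s^2 (c - D) < 0. *)
pose s := (c - D) / (a + (c - D)).
have ac_gt0 : 0 < a + (c - D) by rewrite ltr_wpDl// subr_gt0.
have s_gt0 : 0 < s by rewrite divr_gt0// subr_gt0.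
have s_le1 : s <= 1 by rewrite ler_pdivrMr// mul1r lerDr.
have := opt (th + s *: (v - th)).
rewrite -subr_ge0 lasso_objB [th + _ - th]addrAC subrr add0r.
rewrite -scalemxAr !vdotZr [vdot (s *: _) _]vdotC vdotZr -/c.
have l1s : l1norm (th + s *: (v - th)) <= (1 - s) * l1norm th + s * l1norm v.
  have -> : th + s *: (v - th) = (1 - s) *: th + s *: v.
    by rewrite scalerBr scalerBl scale1r addrA addrAC.
  rewrite (le_trans (l1normD _ _))// !l1normZ !ger0_norm ?subr_ge0//.
  exact: ltW.
have : lam * (l1norm (th + s *: (v - th)) - l1norm th) <= s * D.
  rewrite /D mulrCA ler_wpM2l//; lra.
move=> le1 le2.
have : 0 <= s * (s * a - (c - D)) by rewrite /a; lra.
rewrite pmulr_rge0// leNgt => /negP; apply.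
have -> : s * a - (c - D) = - (s * (c - D)).
  have : s * (a + (c - D)) = c - D by rewrite divfK// gt_eqF.
  clearbody s; lra.
by rewrite oppr_lt0 mulr_gt0// subr_gt0.
Qed.

(** Test the optimality condition at [th] plus or minus a basis vector, which raises the l1 norm by
    at most 1. *)
Lemma lasso_corr_le b th j : 0 <= lam -> lasso_solution b B lam th ->
  `|lasso_corr b th j 0| <= lam.
Proof.
move=> lam_ge0 /(lasso_solutionP _ _ lam_ge0) vi.
have step s : `|s| = 1 -> s * lasso_corr b th j 0 <= lam.
  move=> s1; have := vi (th + s *: delta_mx j 0).
  rewrite [th + _ - th]addrAC subrr add0r vdotZr vdot_delta => /le_trans; apply.
  rewrite -[leRHS]mulr1 ler_wpM2l// lerBlDl addrC addrC.
  by rewrite (le_trans (l1normD _ _))// l1normZ s1 l1norm_delta mul1r.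
have := step 1 (normr1 _); have := step (-1) (normrN1 _).
rewrite mul1r mulN1r => h1 h2.
by rewrite ler_norml h2 andbT lerNl.
Qed.

(** Each optimality condition is tested at the other solution and the two are added, so that the l1
    terms cancel. This is firm nonexpansiveness of the fit [B *m th] as a function of the data. *)
Lemma lasso_monotone b b' th th' : 0 <= lam ->
  lasso_solution b B lam th -> lasso_solution b' B lam th' ->
  vdot (B *m (th - th')) (B *m (th - th')) <= vdot (b - b') (B *m (th - th')).
Proof.
move=> lam_ge0 /(lasso_solutionP _ _ lam_ge0)/(_ th') h.
move=> /(lasso_solutionP _ _ lam_ge0)/(_ th) h'.
have := lerD h h'.
rewrite /lasso_corr ![vdot (_ *m _) _]vdotC -!vdot_mulmx.
rewrite -[th' - th]opprB mulmxN.
set u := th - th'.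
have -> : b - B *m th = (b - b') - B *m u + (b' - B *m th').
  by rewrite /u mulmxBr; apply/colP => i; rewrite !mxE; ring.
set y := B *m u; set r' := b' - B *m th'.
rewrite [vdot (- y) _]vdotC [vdot _ (- y)]vdotNr [vdot (_ + r') _]vdotC vdotDr.
rewrite [vdot y (_ - y)]vdotBr !(vdotC y); lra.
Qed.

Lemma lasso_fit_lipschitz b b' th th' i : 0 <= lam ->
  lasso_solution b B lam th -> lasso_solution b' B lam th' ->
  `|(B *m (th - th')) i 0| <= \sum_k `|b k 0 - b' k 0|.
Proof.
move=> lam_ge0 opt opt'; have := lasso_monotone lam_ge0 opt opt'.
set y := B *m _; set w := b - b' => yw.
have w_ge0 : 0 <= \sum_k `|b k 0 - b' k 0| by rewrite sumr_ge0.
(* Expanding |y - w|^2 >= 0 bounds 2 <w, y> by |y|^2 + |w|^2. *)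
have {yw} yyww : vdot y y <= vdot w w.
  clearbody y w; have := vdot_ge0 (y - w).
  rewrite vdotBr !vdotBl (vdotC y w); lra.
rewrite -(@ler_pXn2r _ 2)// ?nnegrE// real_normK ?num_real//.
apply: (le_trans (y := vdot w w)).
  apply: le_trans yyww; rewrite /vdot (bigD1 i)//= -expr2 lerDl sumr_ge0// => j _.
  by rewrite -expr2 sqr_ge0.
rewrite expr2 mulr_sumr ler_sum// => k _; rewrite !mxE.
apply: le_trans (ler_norm _) _; rewrite normrM ler_wpM2r//.
by rewrite (bigD1 k)//= lerDl sumr_ge0.
Qed.

(** Full column rank gives a left inverse [L] of [B], which carries the Lipschitz bound from the fit
    to the coefficients. Summing all entries of [L] gives one constant for every [j]. *)
Lemma lasso_lipschitz : 0 <= lam -> \rank B = n ->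
  exists C : R, forall b b' th th' j,
    lasso_solution b B lam th -> lasso_solution b' B lam th' ->
    `|th j 0 - th' j 0| <= C * \sum_k `|b k 0 - b' k 0|.
Proof.
move=> lam_ge0 /eqP/row_fullP[L LB].
exists (\sum_j \sum_i `|L j i|) => b b' th th' j opt opt'.
have -> : th j 0 - th' j 0 = (L *m (B *m (th - th'))) j 0.
  by rewrite mulmxA LB mul1mx !mxE.
rewrite mxE (le_trans (ler_norm_sum _ _ _))// (bigD1 j)//= mulrDl mulr_suml.
apply: ler_wpDr.
  by rewrite mulr_ge0 ?sumr_ge0// => k _; rewrite sumr_ge0.
apply: ler_sum => i _; rewrite normrM ler_wpM2l//.
exact: lasso_fit_lipschitz opt opt'.
Qed.

Lemma lasso_unique b th th' : 0 <= lam -> \rank B = n ->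
  lasso_solution b B lam th -> lasso_solution b B lam th' -> th = th'.
Proof.
move=> lam_ge0 Bn opt opt'; have [C lip] := lasso_lipschitz lam_ge0 Bn.
apply/colP => j; apply/eqP; rewrite -subr_eq0 -normr_le0.
rewrite (le_trans (lip _ _ _ _ j opt opt'))// big1 ?mulr0// => k _.
by rewrite subrr normr0.
Qed.

End lasso.


(** * Restriction to the columns in [S] and extension by zero *)

Section restriction.
Variables (R : realType) (n : nat) (S : {set 'I_n}).

(** Written as a product with a column selection of the identity, so that
    [B *m extend v = cols S B *m v] is mere associativity. *)
Definition extend (v : 'cV[R]_#|S|) : 'cV[R]_n := cols S 1%:M *m v.

Lemma cols_mul m (B : 'M[R]_(m, n)) : cols S B = B *m cols S 1%:M.
Proof. by rewrite /cols mulmx_colsub mulmx1. Qed.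

Lemma extend_in v i : extend v (enum_val i) 0 = v i 0.
Proof.
rewrite mxE (bigD1 i)//= big1 ?addr0 => [|j ji].
  by rewrite !mxE eqxx mul1r.
by rewrite !mxE (inj_eq enum_val_inj) eq_sym (negPf ji) mul0r.
Qed.

Lemma extend_notin v j : j \notin S -> extend v j 0 = 0.
Proof.
move=> jS; rewrite mxE big1// => i _; rewrite !mxE.
by case: eqVneq jS => [->|]; rewrite ?enum_valP// mul0r.
Qed.

Lemma sum_split_set (F : 'I_n -> R) :
  \sum_j F j = \sum_(i < #|S|) F (enum_val i) + \sum_(j | j \notin S) F j.
Proof. by rewrite (bigID (mem S))/= [in LHS]big_enum_val. Qed.

Lemma extend_subvec (v : 'cV[R]_n) : vsupp v \subset S -> extend (subvec S v) = v.
Proof.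
move=> /fintype.subsetP vS; apply/colP => j; have [jS|jS] := boolP (j \in S).
  by rewrite -(enum_rankK_in jS jS) extend_in mxE.
rewrite extend_notin//; apply/esym/eqP; apply: contraNT jS => vj.
by apply: vS; rewrite inE.
Qed.

Lemma vsupp_extend (v : 'cV[R]_#|S|) : vsupp (extend v) \subset S.
Proof.
apply/fintype.subsetP => j; rewrite inE; apply: contraNT => jS.
by rewrite extend_notin.
Qed.

(** The optimality condition splits over coordinates. On [S] it is that of the restricted problem;
    off [S] the extension vanishes and the dual bound gives c_j v_j <= lam |v_j|. *)
Lemma lasso_extend m (b : 'cV[R]_m) (B : 'M[R]_(m, n)) lam phi : 0 <= lam ->
  lasso_solution b (cols S B) lam phi ->
  (forall j, j \notin S -> `|lasso_corr B b (extend phi) j 0| <= lam) ->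
  lasso_solution b B lam (extend phi).
Proof.
move=> lam_ge0 /(lasso_solutionP _ _ _ lam_ge0) vi dual.
apply/lasso_solutionP => // v; set c := lasso_corr _ _ _ in dual *.
have := vi (subvec S v).
have -> : lasso_corr (cols S B) b phi = subvec S c.
  rewrite /c /lasso_corr /extend mulmxA -cols_mul.
  by apply/colP => i; rewrite !mxE; apply: eq_bigr => k _; rewrite !mxE.
clearbody c; rewrite /vdot /l1norm !sum_split_set => vin.
have -> : \sum_(j | j \notin S) `|extend phi j 0| = 0.
  by apply: big1 => j jS; rewrite extend_notin// normr0.
have le_out : \sum_(j | j \notin S) c j 0 * (v - extend phi) j 0 <=
    lam * \sum_(j | j \notin S) `|v j 0|.
  rewrite mulr_sumr ler_sum// => j jS.
  rewrite 2!mxE extend_notin// subr0 (le_trans (ler_norm _))// normrM.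
  by rewrite ler_wpM2r// dual.
have -> : \sum_(i < #|S|) `|extend phi (enum_val i) 0| = \sum_i `|phi i 0|.
  by apply: eq_bigr => i _; rewrite extend_in.
have le_in : \sum_(i < #|S|) c (enum_val i) 0 * (v - extend phi) (enum_val i) 0
    <= lam * (\sum_(i < #|S|) `|v (enum_val i) 0| - \sum_i `|phi i 0|).
  move: vin; congr (_ <= lam * (_ - _)); apply: eq_bigr => i _.
    by rewrite [X in X * _]mxE 2![in RHS]mxE extend_in !mxE.
  by rewrite mxE.
lra.
Qed.
End restriction.

(** * Diagonal of the inverse of a symmetric matrix *)

(** Diagonalise over the complex numbers: G = P^* D P with P unitary, so the j-th diagonal entry of
    the inverse is an average of the 1 / D_ii with weights |P_ij|^2. *)
Lemma invmx_sym_diag_le (R : rcfType) (n : nat) (G : 'M[R]_n) (mu : R) :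
  G^T = G -> 0 < mu -> (forall a, eigenvalue G a -> mu <= a) ->
  forall j, invmx G j j <= mu^-1.
Proof.
move=> Gsym mu_gt0 Gmu j.
pose f : {rmorphism R -> R[i]} := real_complex R.
pose G' := map_mx f G; pose P := spectralmx G'; pose dg := spectral_diag G'.
have G'herm : G' \is hermitianmx n false Num.conj.
  apply: realsym_hermsym.
    apply/is_hermitianmxP; rewrite expr0 scale1r map_mx_id//.
    by rewrite /G' map_trmx Gsym.
  by apply/mxOverP => a b; rewrite mxE; apply/complex_realP; exists (G a b).
have G'E : G' = invmx P *m diag_mx dg *m P.
  exact/orthomx_spectralP/hermitian_normalmx.
have Pu : P \in unitmx by exact: spectral_unit.
have PE : invmx P = map_mx Num.conj P^T.
  by apply: invmx_unitary; exact: spectral_unitarymx.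
(* Row i of [P] is a left eigenvector of [G'] for the real number [dg 0 i], which is therefore an
   eigenvalue of [G] itself; it is nonzero because [P] is invertible. *)
have dg_ge i : f mu <= dg 0 i.
  have /complex_realP[x dgE] : dg 0 i \is Num.real.
    exact/mxOverP/hermitian_spectral_diag_real.
  rewrite dgE lecR; apply: Gmu; rewrite -(eigenvalue_map f) -[f x]/(x%:C)%C -dgE.
  apply/eigenvalueP; exists (row i P).
    rewrite -/G' G'E -!row_mul !mulmxA mulmxV// mul1mx.
    by rewrite row_mul row_diag_mx -scalemxAl -rowE.
  apply/negP => /eqP Pi0; have := oner_neq0 R[i].
  have := congr1 (fun M : 'M[R[i]]_n => M i i) (mulmxV Pu).
  have -> : (P *m invmx P) i i = (row i P *m invmx P) 0 i by rewrite -row_mul [RHS]mxE.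
  by rewrite Pi0 mul0mx !mxE eqxx mulr1n => <-; rewrite eqxx.
have fmu_gt0 : 0 < f mu by rewrite ltcR.
have dg_gt0 i : 0 < dg 0 i by exact: lt_le_trans (dg_ge i).
pose dgV := \row_i (dg 0 i)^-1.
have G'V : invmx G' = invmx P *m diag_mx dgV *m P.
  have G'K : invmx P *m diag_mx dgV *m P *m G' = 1%:M.
    rewrite G'E !mulmxA mulmxK// -[_ *m diag_mx dg]mulmxA.
    suff -> : diag_mx dgV *m diag_mx dg = 1%:M by rewrite mulmx1 mulVmx.
    rewrite mul_diag_mx; apply/matrixP => a c; rewrite !mxE.
    by case: eqVneq => [->|_]; rewrite ?mulr0// mulr1n mulVf// gt_eqF.
  have [_ G'u] := mulmx1_unit G'K.
  by rewrite -[LHS]mul1mx -G'K mulmxK.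
rewrite -lecR -[leLHS]/(f _) -[leRHS]/(f _) fmorphV.
have -> : f (invmx G j j) = (invmx G') j j by rewrite /G' -map_invmx mxE.
(* The weights sum to 1 because column j of the unitary [P] has norm one. *)
have -> : (f mu)^-1 = \sum_i (f mu)^-1 * `|P i j| ^+ 2.
  rewrite -mulr_sumr.
  have := congr1 (fun M : 'M[R[i]]_n => M j j) (mulVmx Pu).
  rewrite /= PE !mxE eqxx => E; rewrite -[LHS]mulr1 -[1 in LHS]E.
  by congr (_ * _); apply: eq_bigr => i _; rewrite !mxE normCK mulrC.
rewrite G'V mul_mx_diag mxE; apply: ler_sum => i _.
rewrite PE !mxE [X in X * _]mulrC -mulrA [X in _ * X <= _]mulrC -normCK.
by rewrite ler_wpM2r ?exprn_ge0 ?lef_pV2 ?posrE.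
Qed.

(** * Independence and subgaussian tails *)

Section indicator_to_function.
Import HBNNSimple.
Context d (T : measurableType d) (R : realType)
  (P : {measure set T -> \bar R}).
Variables (X : T -> R) (G : T -> R) (c : \bar R).
Hypothesis mX : measurable_fun setT X.
Hypothesis mG : measurable_fun setT G.
Hypothesis G_ge0 : forall w, 0 <= G w.
Hypothesis c_ge0 : (0 <= c)%E.
Hypothesis indic_le : forall A : set R, measurable A ->
  (\int[P]_w (\1_A (X w) * G w)%:E <= c * \int[P]_w (\1_A (X w))%:E)%E.

(** A simple function is a finite combination of indicators of its level sets with nonnegative
    coefficients, so the bound follows by linearity. *)
Lemma integral_mul_le_nnsfun (g : {nnsfun R >-> R}) :
  (\int[P]_w (g (X w) * G w)%:E <= c * \int[P]_w (g (X w))%:E)%E.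
Proof.
set s := fset_set (g @` setT).
pose A (i : 'I_#|`s|) := g @^-1` [set s`_i].
have mA i : measurable (A i) by exact: measurable_funPTI.
(* Past the end of [s] the default value of [nth] is 0, so every index is covered. *)
have s_ge0 i : 0 <= s`_i.
  have [i_lt|i_ge] := ltnP i (size s); last by rewrite nth_default.
  have : s`_i \in s by rewrite mem_nth.
  by rewrite in_fset_set; [case/set_mem => x _ <-|exact: fimfunP].
have mAX i : measurable_fun setT (fun w => \1_(A i) (X w) : R).
  exact: (measurableT_comp (measurable_indic (mA i)) mX).
under eq_integral do rewrite fimfunEord mulr_suml -sumEFin.
rewrite ge0_integral_sum//; last 2 first.
- move=> i; apply/measurable_EFinP; apply: measurable_funM => //.
  by apply: measurable_funM => //; exact: mAX.
- by move=> i x _; rewrite lee_fin !mulr_ge0.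
under [in leRHS]eq_integral do rewrite fimfunEord -sumEFin.
rewrite ge0_integral_sum//; last 2 first.
- by move=> i; apply/measurable_EFinP; apply: measurable_funM => //; exact: mAX.
- by move=> i x _; rewrite lee_fin !mulr_ge0.
rewrite ge0_sume_distrr; last first.
  by move=> i _; apply: integral_ge0 => x _; rewrite lee_fin mulr_ge0.
apply: lee_sum => i _.
under eq_integral do rewrite -mulrA EFinM.
under [in leRHS]eq_integral do rewrite EFinM.
rewrite !ge0_integralZl_EFin//; last 3 first.
- exact/measurable_EFinP/mAX.
- by move=> x _; rewrite lee_fin mulr_ge0.
- by apply/measurable_EFinP; apply: measurable_funM => //; exact: mAX.
by rewrite muleCA lee_wpmul2l ?lee_fin// indic_le.
Qed.

(** Monotone convergence along increasing simple functions, each of which lies below its limit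
    [f]. *)
Lemma integral_mul_le (f : R -> R) : measurable_fun setT f -> (forall x, 0 <= f x) ->
  (\int[P]_w (f (X w) * G w)%:E <= c * \int[P]_w (f (X w))%:E)%E.
Proof.
move=> mf f_ge0.
have mEf : measurable_fun setT (EFin \o f) by exact/measurable_EFinP.
have [|g [g_nd g_cvg]] := approximation measurableT mEf.
  by move=> t _; rewrite lee_fin.
have mgX n : measurable_fun setT (fun w => g n (X w)).
  by apply: measurableT_comp mX.
have -> : (\int[P]_w (f (X w) * G w)%:E =
    \int[P]_w limn (fun n => (g n (X w) * G w)%:E))%E.
  apply: eq_integral => w _; apply/esym/cvg_lim => //.
  rewrite EFinM muleC; under eq_fun do rewrite EFinM muleC.
  by apply: cvgeZl => //; exact: g_cvg.
rewrite monotone_convergence//; last 3 first.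
- by move=> n; apply/measurable_EFinP; exact: measurable_funM.
- by move=> n w _; rewrite lee_fin mulr_ge0.
- by move=> w _ m n mn; rewrite lee_fin ler_wpM2r//; exact/lefP/g_nd.
apply: lime_le.
  apply: ereal_nondecreasing_is_cvgn => m n mn; apply: ge0_le_integral => //.
  - by move=> w _; rewrite lee_fin mulr_ge0.
  - by apply/measurable_EFinP; exact: measurable_funM.
  - by apply/measurable_EFinP; exact: measurable_funM.
  - by move=> w _; rewrite lee_fin ler_wpM2r//; exact/lefP/g_nd.
apply: nearW => n; apply: le_trans (integral_mul_le_nnsfun _) _.
rewrite lee_wpmul2l// ge0_le_integral//.
- by move=> w _; rewrite lee_fin.
- exact/measurable_EFinP.
- by apply/measurable_EFinP; exact: measurableT_comp.
- move=> w _; rewrite -[leRHS](cvg_lim _ (g_cvg (X w) I))//.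
  apply: lime_ge; first by apply/cvg_ex; eexists; exact: g_cvg.
  near=> m; rewrite /= lee_fin; apply/lefP/g_nd; near: m; exact: nbhs_infty_ge.
Unshelve. all: by end_near. Qed.
End indicator_to_function.

(* The functions [f i] are released one at a time from being indicators, the case
   of indicators being the definition of independence. *)
Lemma expectation_prod_le d (T : measurableType d) (R : realType)
    (P : probability T R) (I : finType) (X : I -> {RV P >-> R})
    (f : I -> R -> R) :
  independent_rvs X ->
  (forall i, measurable_fun setT (f i)) -> (forall i x, 0 <= f i x) ->
  (\int[P]_w (\prod_i f i (X i w))%:E <= \prod_i \int[P]_w (f i (X i w))%:E)%E.
Proof.
move=> indep.
suff claim (s : seq I) : forall g : I -> R -> R,
    (forall i, measurable_fun setT (g i)) -> (forall i x, 0 <= g i x) ->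
    (forall i, i \notin s -> exists2 A, measurable A & g i = \1_A) ->
    (\int[P]_w (\prod_i g i (X i w))%:E
      <= \prod_i \int[P]_w (g i (X i w))%:E)%E.
  by move=> mf f0; apply: (claim (enum I)) => // i; rewrite mem_enum.
elim: s => [g mg g0 gI|j s IH g mg g0 gI].
  have /choice[A AP] : forall i, exists A, measurable A /\ g i = \1_A.
    by move=> i; have [//|A mA gA] := gI i; exists A.
  have gA i w : g i (X i w) = \1_(X i @^-1` A i) w.
    by rewrite (AP i).2 !indicE.
  have mXA i : measurable (X i @^-1` A i) by apply: measurable_funPTI; exact: (AP i).1.
  rewrite [leRHS](eq_bigr (fun i => P (X i @^-1` A i))); last first.
    move=> i _; under eq_integral do rewrite gA.
    by rewrite integral_indic// setIT.
  have := indep [set: I]%SET A (fun i => (AP i).1).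
  rewrite [X in _ = X -> _](eq_bigl predT); last by move=> i; rewrite finset.in_setT.
  move=> <-.
  under eq_integral.
    move=> w _.
    have -> : \prod_i g i (X i w) =
        \1_[set w | forall i, i \in [set: I]%SET -> A i (X i w)] w.
      under eq_bigr do rewrite gA.
      rewrite indicE; case: (boolP (_ \in _)) => [/set_mem /= Aw|Aw].
        apply: big1 => i _; rewrite indicE mem_set//.
        by apply: Aw; rewrite finset.in_setT.
      have [i Ai] : exists i, ~ A i (X i w).
        apply/existsNP => Aw'; move/negP: Aw; apply.
        by apply: mem_set => i _; exact: Aw'.
      by rewrite (bigD1 i)//= indicE memNset// mul0r.
    over.
  rewrite integral_indic ?setIT//.
  rewrite [X in measurable X](_ : _ = \bigcap_(i in [set: I]) (X i @^-1` A i)).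
    by apply: fin_bigcap_measurable => //; exact: finite_finset.
  apply/seteqP; split=> w /= Aw i; first by move=> _; apply: Aw; rewrite finset.in_setT.
  by move=> _; exact: Aw.
under eq_integral do rewrite (bigD1 j)//=.
rewrite (bigD1 j)//= muleC.
(* The factor of [j] is the function to be released; the product of the others serves as the weight.
   The required bound on indicators is the induction hypothesis with [g j] replaced by [\1_A]. *)
apply: (@integral_mul_le _ _ _ P (X j) (fun w => \prod_(i | i != j) g i (X i w))
   (\prod_(i | i != j) \int[P]_w (g i (X i w))%:E)%E) => //.
- pose s' := [seq i <- index_enum I | i != j].
  rewrite (_ : (fun w => _) = (fun w => \prod_(i <- s') g i (X i w))).
    apply: measurable_prod => i _.
    exact: (measurableT_comp (mg i) (measurable_funPT (X i))).
  by apply/funext => w; rewrite big_filter.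
- by move=> w; apply: prodr_ge0.
- by apply: prode_ge0 => i _; apply: integral_ge0 => w _; rewrite lee_fin.
move=> A mA; pose g' i := if i == j then \1_A : R -> R else g i.
have g'j : g' j = \1_A by rewrite /g' eqxx.
have g'i i : i != j -> g' i = g i by rewrite /g' => /negPf ->.
have := IH g' _ _ _.
rewrite (bigD1 j)//= g'j muleC.
rewrite (eq_bigr (fun i => \int[P]_w (g i (X i w))%:E)%E); last by move=> i /g'i ->.
under eq_integral do rewrite (bigD1 j)//= g'j.
under eq_integral.
  move=> w _.
  rewrite (eq_bigr (fun i => g i (X i w))); last by move=> i /g'i ->.
  over.
apply.
- move=> i; rewrite /g'; case: eqVneq => // _; exact: measurable_indic.
- by move=> i x; rewrite /g'; case: eqVneq.
- move=> i i_s; rewrite /g'; case: eqVneq => [_|ij]; first by exists A.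
  by apply: gI; rewrite inE negb_or ij.
Qed.

Lemma lee_prod (R : realDomainType) (I : Type) (s : seq I) (f g : I -> \bar R) :
  (forall i, 0 <= f i)%E -> (forall i, f i <= g i)%E ->
  (\prod_(i <- s) f i <= \prod_(i <- s) g i)%E.
Proof.
move=> f0 fg; elim: s => [|i s IH]; first by rewrite !big_nil.
by rewrite !big_cons lee_pmul//; apply: prode_ge0.
Qed.

Section subgaussian_tail.
Context d (T : measurableType d) (R : realType) (P : probability T R).
Variables (I : finType) (X : I -> {RV P >-> R}) (s2 : R).
Hypothesis indep : independent_rvs X.
Hypothesis subg : forall i, subgaussian (X i) s2.

(** The exponential of the sum is a product of functions of the single [X i], so independence
    reduces the claim to the moment generating function of each [X i] at [a i * t]. *)
Lemma mmt_gen_fun_sum_le (a : I -> R) (t : R) :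
  ('M_P (fun w => \sum_i a i * X i w)%R t
    <= (expR (s2 * (\sum_i a i ^+ 2) * t ^+ 2 / 2))%:E)%E.
Proof.
rewrite /mmt_gen_fun unlock /=.
pose f (i : I) (x : R) : R := expR (x * (a i * t)).
rewrite (eq_integral (fun w => (\prod_i f i (X i w))%:E)); last first.
  move=> w _; rewrite -expR_sum mulrC mulr_sumr; congr (expR _)%:E.
  apply: eq_bigr => i _.
  by rewrite [RHS]mulrC [a i * t]mulrC mulrA.
have mf i : measurable_fun setT (f i).
  by apply: measurableT_comp => //; exact: mulrr_measurable.
apply: (le_trans (expectation_prod_le indep mf _)).
  by move=> i x; exact: expR_ge0.
rewrite mulr_sumr !mulr_suml expR_sum -prodEFin.
suff Xle i : (\int[P]_w (f i (X i w))%:E <=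
    (expR (s2 * a i ^+ 2 * t ^+ 2 / 2))%:E)%E.
  have Xge i : (0 <= \int[P]_w (f i (X i w))%:E)%E.
    by apply: integral_ge0 => w _; rewrite lee_fin expR_ge0.
  exact: lee_prod.
have [_ _ /(_ (a i * t))] := subg i.
rewrite /mmt_gen_fun unlock /= => /le_trans; apply.
by rewrite lee_fin ler_expR exprMn !mulrA.
Qed.

Lemma measurable_lin_comb (a : I -> R) :
  measurable_fun setT (fun w => \sum_i a i * X i w).
Proof. by apply: measurable_sum => i; exact: measurable_funM. Qed.

Lemma subgaussian_sum_ge (a : I -> R) (v t : R) : 0 < s2 -> 0 < v ->
  \sum_i a i ^+ 2 <= v -> 0 < t ->
  (P [set w | t <= \sum_i a i * X i w]%R <= (expR (- (t ^+ 2 / (2 * s2 * v))))%:E)%E.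
Proof.
move=> s2_gt0 v_gt0 av t_gt0.
pose L : {RV P >-> R} := HB.pack (fun w => \sum_i a i * X i w)
  (isMeasurableFun.Build _ _ _ _ _ (measurable_lin_comb a)).
(* The minimiser of the Chernoff exponent s2 v r^2 / 2 - r t. *)
pose r := t / (s2 * v).
have r_gt0 : 0 < r by rewrite divr_gt0// mulr_gt0.
apply: (le_trans (chernoff L t r_gt0)).
apply: (@le_trans _ _ ((expR (s2 * v * r ^+ 2 / 2))%:E * (expR (- (r * t)))%:E)%E).
  rewrite lee_wpmul2r ?lee_fin ?expR_ge0//.
  apply: (le_trans (mmt_gen_fun_sum_le a r)).
  rewrite lee_fin ler_expR ler_wpM2r ?invr_ge0// ler_wpM2r ?sqr_ge0//.
  by rewrite ler_wpM2l// ltW.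
rewrite -EFinM -expRD lee_fin ler_expR /r le_eqVlt; apply/orP; left; apply/eqP.
field; apply/andP; split; lra.
Qed.

Lemma subgaussian_sum_tail (a : I -> R) (v t : R) : 0 < s2 -> 0 < v ->
  \sum_i a i ^+ 2 <= v -> 0 < t ->
  (P [set w | t < `|\sum_i a i * X i w|]%R
    <= (2 * expR (- (t ^+ 2 / (2 * s2 * v))))%:E)%E.
Proof.
move=> s2_gt0 v_gt0 av t_gt0.
have mL b : measurable [set w | t <= \sum_i b i * X i w].
  rewrite -[[set _ | _]]setTI.
  by apply: measurable_fun_le => //; exact: measurable_lin_comb.
(* The two tails are upper tails for the coefficients [a] and [- a], which have the same sum of
   squares. *)
pose U := [set w | t <= \sum_i a i * X i w] `|` [set w | t <= \sum_i - a i * X i w].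
apply: (@le_trans _ _ (P U)).
  apply: le_measure; [apply/mem_set|apply/mem_set|].
  - rewrite (_ : [set w | _] = ~` [set w | `|\sum_i a i * X i w| <= t]).
      apply: measurableC; rewrite -[[set _ | _]]setTI.
      apply: measurable_fun_le => //.
      by apply: measurableT_comp => //; exact: measurable_lin_comb.
    by apply/seteqP; split=> w /=; rewrite ltNge => /negP.
  - exact: measurableU.
  - have sumN w : \sum_i - a i * X i w = - \sum_i a i * X i w.
      by rewrite -sumrN; apply: eq_bigr => i _; rewrite mulNr.
    move=> w; rewrite /U/= sumN; case: ger0P => _ /ltW; by [left|right].
apply: (le_trans (measureU2 P _ _)) => //.
rewrite mulr_natl mulr2n EFinD leeD//; first exact: subgaussian_sum_ge.
apply: subgaussian_sum_ge => //.
by under eq_bigr do rewrite sqrrN.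
Qed.
End subgaussian_tail.

(** * Measurability and union bound *)

(* The values [X i w] are approximated by rationals, but [h] can only be evaluated
   on [T]: [pt p] is a sample point chosen in the cell [p] of the net, whenever
   this cell is nonempty. *)
Lemma measurable_lipschitz d (T : measurableType d) (R : realType)
    (I : finType) (X : I -> T -> R) (h : T -> R) (C : R) :
  (forall i, measurable_fun setT (X i)) -> 0 <= C ->
  (forall w w', `|h w - h w'| <= C * \sum_i `|X i w - X i w'|) ->
  measurable_fun setT h.
Proof.
move=> mX C_ge0 lip mT; apply: (measurability _ (RGenOInfty.measurableE R)) => //.
move=> _ [_ [a ->] <-]; rewrite setTI.
have [[w0 _]|T0] := pselect (exists w : T, True); last first.
  by rewrite (_ : _ @^-1` _ = set0)//; apply/seteqP; split=> w //; case: T0; exists w.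
pose near_pt (p : {ffun I -> rat} * nat) w :=
  forall i, `|X i w - ratr (p.1 i)| < p.2.+1%:R^-1.
have /choice[pt ptP] : forall p, exists w, (exists w', near_pt p w') -> near_pt p w.
  move=> p; have [[w pw]|no] := pselect (exists w', near_pt p w'); first by exists w.
  by exists w0.
(* By the Lipschitz bound [approx p] lies below [h], and it is measurable since it depends on [w]
   only through the [X i w]. *)
pose approx p w := h (pt p) - C * \sum_i `|X i w - X i (pt p)|.
have -> : h @^-1` `]a, +oo[ = \bigcup_p ~` [set w | approx p w <= a].
  apply/seteqP; split=> w; rewrite /= in_itv/= andbT; last first.
    move=> [p _ /=] /negP; rewrite -ltNge => /lt_le_trans; apply.
    rewrite lerBlDl -lerBlDr (le_trans (ler_norm _))// distrC.
    exact: lip.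
  move=> ahw; have e_gt0 : 0 < h w - a by rewrite subr_gt0.
  (* Within cell [p], [approx p] falls short of [h] by at most twice [C] times a sum of #|I|
     distances, each at most 2 / (n + 1). *)
  pose K := 4 * C * #|I|%:R.
  have K_ge0 : 0 <= K by rewrite !mulr_ge0.
  pose n := Num.bound (K / (h w - a)).
  have Kn : K * n.+1%:R^-1 < h w - a.
    rewrite ltr_pdivrMr// -ltr_pdivrMl// mulrC.
    rewrite (lt_trans (archi_boundP _)) ?ltr_nat// divr_ge0//.
    exact: ltW.
  have /choice[q qP] : forall i, exists q : rat, `|X i w - ratr q| < n.+1%:R^-1.
    move=> i; have [|q] := @rat_in_itvoo _ (X i w) (X i w + n.+1%:R^-1).
      by rewrite ltrDl invr_gt0.
    rewrite in_itv/= => /andP[q1 q2]; exists q.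
    by rewrite distrC gtr0_norm ?subr_gt0// ltrBlDl.
  pose p := ([ffun i => q i], n); exists p => //.
  have pw : near_pt p w by move=> i; rewrite ffunE; exact: qP.
  have ppt : near_pt p (pt p) by apply: ptP; exists w.
  have sum_le : \sum_i `|X i w - X i (pt p)| <= #|I|%:R * (2 * n.+1%:R^-1).
    rewrite mulr_natl -sumr_const; apply: ler_sum => i _.
    rewrite (le_trans (ler_distD (ratr (p.1 i)) _ _))// mulr_natl mulr2n lerD//.
      exact/ltW/pw.
    by rewrite distrC; exact/ltW/ppt.
  apply/negP; rewrite -ltNge /approx.
  have /(le_trans (ler_norm _)) := lip w (pt p).
  have : C * \sum_i `|X i w - X i (pt p)| <= C * (#|I|%:R * (2 * n.+1%:R^-1)).
    exact: ler_wpM2l.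
  move: Kn; rewrite /K; move: (\sum_i _) (h (pt p)) => s hp.
  move: (n.+1%:R^-1) => u; lra.
apply: countable_bigcupT_measurable => // p; apply: measurableC.
rewrite -[[set _ | _]]setTI; apply: measurable_fun_le => //.
apply: measurable_funB => //; apply: measurable_funM => //.
apply: measurable_sum => i; apply: measurableT_comp => //.
exact: measurable_funB.
Qed.

Lemma measurable_forall d (T : measurableType d) (K : finType) (E : K -> set T) :
  (forall k, measurable (E k)) -> measurable [set w | forall k, E k w].
Proof.
move=> mE; rewrite (_ : [set w | _] = \bigcap_(k in [set: K]) E k).
  by apply: fin_bigcap_measurable => //; exact: finite_finset.
by apply/seteqP; split=> w /= Ew k; [move=> _; exact: Ew|exact: Ew].
Qed.

Lemma probability_forall_ge d (T : measurableType d) (R : realType)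
    (P : probability T R) (K : finType) (E : K -> set T) (p : R) :
  (forall k, measurable (E k)) -> (forall k, P (~` E k) <= p%:E)%E ->
  ((1 - #|K|%:R * p)%:E <= P [set w | forall k, E k w])%E.
Proof.
move=> mE Ep.
have -> : [set w | forall k, E k w] = ~` \bigcup_k ~` E k.
  apply/seteqP; split=> w /=; first by move=> Ew [k _]; apply; exact: Ew.
  by move=> Ew k; apply: contrapT => Ek; apply: Ew; exists k.
have mU : measurable (\bigcup_k ~` E k).
  apply: countable_bigcupT_measurable => // k; exact: measurableC.
rewrite probability_setC// EFinB leeB//.
have := @content_sub_fsum _ _ _ P K setT (\bigcup_k ~` E k) (fun k => ~` E k).
move=> /(_ finite_finset) /(_ (fun k _ => measurableC (mE k)) mU).
move=> /(_ (@subset_refl _ _))/le_trans; apply.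
have -> : [set: K] = [set` (predT : {pred K})] by apply/seteqP; split.
rewrite -(@bigfs _ _ _ _ (index_enum K) predT); first last.
- by move=> k _; rewrite mem_index_enum.
- exact: index_enum_uniq.
rewrite mulr_natl -sumr_const -sumEFin.
rewrite [leRHS](eq_bigl (predT : pred K)) => [|k]; last by rewrite inE.
by apply: (@lee_sum _ K _ _ (index_enum K) predT) => k _; exact: Ep.
Qed.

(** * Primal-dual witness *)

Lemma opnorm_inf_mul (R : realType) m n (M : 'M[R]_(m, n)) (v : 'cV[R]_n) lam i :
  0 <= lam -> (forall j, `|v j 0| <= lam) ->
  `|(M *m v) i 0| <= lam * opnorm_inf M.
Proof.
move=> lam_ge0 v_le; apply: (@le_trans _ _ (lam * \sum_j `|M i j|)); last first.
  by rewrite ler_wpM2l// /opnorm_inf; exact: (le_bigmax _ (fun i => \sum_j `|M i j|)).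
rewrite mxE mulr_sumr (le_trans (ler_norm_sum _ _ _))//; apply: ler_sum => j _.
by rewrite normrM mulrC ler_wpM2r.
Qed.

Lemma lambda_min_le_eigenvalue (R : realType) n (M : 'M[R]_n) (mu a : R) :
  (mu%:E <= lambda_min M)%E -> eigenvalue M a -> mu <= a.
Proof.
move=> mu_le Ma; rewrite -lee_fin; apply: le_trans mu_le _.
by apply: ereal_inf_lbound; exists a.
Qed.

(** A nonzero kernel would make 0 an eigenvalue, below [mu]. *)
Lemma unitmx_lambda_min (R : realType) n (M : 'M[R]_n) (mu : R) :
  0 < mu -> (mu%:E <= lambda_min M)%E -> M \in unitmx.
Proof.
move=> mu_gt0 mu_le; rewrite -row_free_unit -kermx_eq0; apply: contraTT mu_gt0.
move=> kerM; rewrite -leNgt; apply: lambda_min_le_eigenvalue mu_le _.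
by rewrite /eigenvalue /eigenspace raddf0 subr0.
Qed.

Section primal_dual_witness.
Variables (R : realType) (m n : nat) (B : 'M[R]_(m, n)) (S : {set 'I_n}).
Let A := cols S B.
Let G := A^T *m A.
Let W := invmx G *m A^T.
Hypothesis Gu : G \in unitmx.

Lemma gram_sym : G^T = G.
Proof. by rewrite trmx_mul trmxK. Qed.

Lemma pinv_mul : W *m A = 1%:M.
Proof. by rewrite -mulmxA mulVmx. Qed.

Lemma rank_cols : \rank A = #|S|.
Proof. by apply/eqP/row_fullP; exists W; exact: pinv_mul. Qed.

(** Diagonal of W W^T = G^-1. It controls the subgaussian parameter of the i-th entry of
    [W *m e]. *)
Lemma pinv_row_norm i : \sum_k W i k ^+ 2 = invmx G i i.
Proof.
transitivity ((W *m W^T) i i).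
  by rewrite [RHS]mxE; apply: eq_bigr => k _; rewrite [W^T _ _]mxE expr2.
by rewrite trmx_mul trmxK trmx_inv gram_sym mulmxA pinv_mul mul1mx.
Qed.

Lemma proj_sym : (A *m W)^T = A *m W.
Proof. by rewrite /W !trmx_mul trmxK trmx_inv gram_sym mulmxA. Qed.

(** [A *m W] is symmetric and idempotent, hence |x - A W x|^2 = |x|^2 - |A W x|^2. *)
Lemma residual_norm (x : 'cV[R]_m) :
  vdot ((1%:M - A *m W) *m x) ((1%:M - A *m W) *m x) <= vdot x x.
Proof.
have QQ : vdot (A *m W *m x) (A *m W *m x) = vdot x (A *m W *m x).
  have QQ : A *m W *m (A *m W) = A *m W.
    by rewrite (mulmxA (A *m W) A W) -(mulmxA A W A) pinv_mul mulmx1.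
  by rewrite vdot_mulmx proj_sym (mulmxA (A *m W)) QQ.
rewrite mulmxBl mul1mx vdotBr !vdotBl (vdotC _ x) QQ.
have := vdot_ge0 (A *m W *m x); rewrite QQ; lra.
Qed.

Variables (lam : R) (theta : 'cV[R]_n) (e : 'cV[R]_m) (phi : 'cV[R]_#|S|).
Let b := B *m theta + e.
Let c := lasso_corr A b phi.
Hypothesis theta_supp : vsupp theta \subset S.

(** As [theta] is supported in [S], the data are A theta_S + e; apply the left inverse [W] of [A] to
    the residual. *)
Lemma witness_error : phi - subvec S theta = W *m e - invmx G *m c.
Proof.
have -> : invmx G *m c = W *m (b - A *m phi) by rewrite /c /lasso_corr mulmxA.
have -> : b = A *m subvec S theta + e.
  by rewrite /b -{1}(extend_subvec theta_supp) /extend mulmxA -cols_mul.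
rewrite mulmxBr mulmxDr !(mulmxA W A) pinv_mul !mul1mx.
set u := W *m e; clearbody u; apply/colP => i.
by rewrite !mxE; ring.
Qed.

Lemma witness_dual j :
  lasso_corr B b (extend phi) j 0 =
  vdot ((1%:M - A *m W) *m col j B) e + (B^T *m A *m invmx G *m c) j 0.
Proof.
(* Noise orthogonal to the range of [A], plus a vector in that range. The symmetric projection is
   later moved from [e] onto column j of [B], leaving a linear form in the noise. *)
have res : b - B *m extend phi = (1%:M - A *m W) *m e + A *m (invmx G *m c).
  rewrite mulmxBl mul1mx -[invmx G *m c]opprK -[- (invmx G *m c)](addKr (W *m e)).
  rewrite -witness_error /b /extend -{1}(extend_subvec theta_supp) /extend.
  rewrite !(mulmxA B) -cols_mul -/A.
  rewrite mulmxN mulmxDr mulmxN mulmxBr.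
  rewrite -(mulmxA A W e).
  set x := A *m _; set y := A *m _; set z := A *m _; clearbody x y z.
  by apply/colP => i; rewrite !mxE; ring.
rewrite /lasso_corr res mulmxDr [LHS]mxE; congr (_ + _); last first.
  by rewrite (mulmxA _ A) (mulmxA _ (invmx G)).
have -> : col j B = B *m delta_mx j 0 by rewrite colE.
rewrite vdot_mulmx vdot_mulmx vdotC vdot_delta.
by rewrite linearB/= trmx1 proj_sym.
Qed.
End primal_dual_witness.

(** * Measurability of the solutions and the final probability bounds *)

Lemma measurable_lasso d (T : measurableType d) (R : realType) m n
    (b : T -> 'cV[R]_m) (B : 'M[R]_(m, n)) (lam : R) (th : T -> 'cV[R]_n) j :
  (forall i, measurable_fun setT (fun w => b w i 0)) ->
  0 <= lam -> \rank B = n -> (forall w, lasso_solution (b w) B lam (th w)) ->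
  measurable_fun setT (fun w => th w j 0).
Proof.
move=> mb lam_ge0 Bn opt; have [C lip] := lasso_lipschitz lam_ge0 Bn.
apply: (@measurable_lipschitz _ _ _ _ (fun i w => b w i 0) _ `|C|) => // w w'.
apply: le_trans (lip _ _ _ _ j (opt w) (opt w')) _.
by rewrite ler_wpM2r ?sumr_ge0// ler_norm.
Qed.

Theorem theorem5p1 (R : realType) (d : measure_display) (T : measurableType d)
    (P : probability T R)
    (I J K N r k : nat)
    (I_gt0 : (0 < I)%N) (J_gt0 : (0 < J)%N) (K_gt0 : (0 < K)%N)
    (N_def : N = (I * J * K)%N)
    (lam : R) (lam_gt0 : 0 < lam)
    (B : 'M[R]_(N, r))
    (B_rank : \rank B = r)
    (B_unit : forall j : 'I_r, l2norm (col j B) = 1)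
    (theta : 'cV[R]_r) (S : {set 'I_r})
    (S_def : S = vsupp theta) (S_card : #|S| = k) (k_lt : (k < r)%N)
    (sigma : R) (sigma2_gt0 : 0 < sigma ^+ 2)
    (eps : 'I_N -> {RV P >-> R})
    (eps_indep : independent_rvs eps)
    (eps_subg : forall i, subgaussian (eps i) (sigma ^+ 2))
    (b : T -> 'cV[R]_N)
    (b_def : forall w, b w = B *m theta + \col_i eps i w)
    (gamma mu : R) (gamma_gt0 : 0 < gamma) (gamma_lt1 : gamma < 1)
    (mu_gt0 : 0 < mu)
    (incoherence :
      opnorm_inf ((cols (~: S) B)^T *m cols S B *m
                  invmx ((cols S B)^T *m cols S B)) <= 1 - gamma)
    (min_eig : (mu%:E <= lambda_min ((cols S B)^T *m cols S B))%E)
    (theta_hat : T -> 'cV[R]_r)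
    (theta_hat_opt : forall w, lasso_solution (b w) B lam (theta_hat w))
    (thetaS_hat : T -> 'cV[R]_#|S|)
    (thetaS_hat_opt :
      forall w, lasso_solution (b w) (cols S B) lam (thetaS_hat w)) :
  let kappa : R := opnorm_inf (invmx ((cols S B)^T *m cols S B)) in
  let delta (w : T) : 'cV[R]_#|S| := thetaS_hat w - subvec S theta in
  let prob_bound : R :=
    1 - 2 * r%:R * expR (- (lam ^+ 2 * gamma ^+ 2 / (8 * sigma ^+ 2))) in
  let event : set T :=
    [set w | vsupp (theta_hat w) \subset S] `&`
    [set w | `|delta w| <= lam / (2 * Num.sqrt mu) + lam * kappa] in
  (prob_bound%:E <= P event)%E
  /\
  ((forall j, j \in S ->
      lam * (1 / (2 * Num.sqrt mu) + kappa) < `|theta j 0|) ->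
   (prob_bound%:E <= P [set w | vsupp (theta_hat w) = S])%E).


Proof.
clear I J K I_gt0 J_gt0 K_gt0 N_def k S_card k_lt.
move=> kappa delta prob_bound event.
have lam_ge0 := ltW lam_gt0.
have kappa_ge0 : 0 <= kappa by exact: bigmax_ge_id.
pose A := cols S B; pose G := A^T *m A.
have Gu : G \in unitmx := unitmx_lambda_min mu_gt0 min_eig.
have thS : vsupp theta \subset S by rewrite S_def.
pose W := invmx G *m A^T.
pose t1 := lam / (2 * Num.sqrt mu).
have smu_gt0 : 0 < Num.sqrt mu by rewrite sqrtr_gt0.
have t1_gt0 : 0 < t1 by rewrite divr_gt0// mulr_gt0.
(* One noise bound per column of [B]: an entry of W eps for a column in [S], a residual correlation
   for a column outside. The union bound thus has exactly [r] terms. *)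
pose Ix := ('I_#|S| + 'I_#|~: S|)%type.
pose a (k : Ix) (m : 'I_N) : R := match k with
  | inl i => W i m
  | inr j => ((1%:M - A *m W) *m col (enum_val j) B) m 0 end.
pose t (k : Ix) : R := if k is inl _ then t1 else lam * gamma.
pose E (k : Ix) := [set w | `|\sum_m a k m * eps m w| <= t k].
pose good := [set w | forall k, E k w].
have mE (k : Ix) : measurable (E k).
  rewrite -[E k]setTI; apply: measurable_fun_le => //.
  by apply: measurableT_comp => //; exact: measurable_lin_comb.
have card_Ix : #|{: Ix}| = r.
  by rewrite card_sum !card_ord cardsC card_ord.
pose q := 2 * expR (- (lam ^+ 2 * gamma ^+ 2 / (8 * sigma ^+ 2))) : R.
have tail (k : Ix) : (P (~` E k) <= q%:E)%E.
  have -> : ~` E k = [set w | t k < `|\sum_m a k m * eps m w|].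
    by apply/seteqP; split=> w /=; rewrite ltNge => /negP.
  have lg_le : lam ^+ 2 * gamma ^+ 2 <= lam ^+ 2.
    by rewrite ler_piMr ?sqr_ge0// expr_le1 ?ltW.
  have s8_gt0 : 0 < 8 * sigma ^+ 2 by rewrite mulr_gt0.
  have le_q v : 0 < v -> 0 < t k -> \sum_m a k m ^+ 2 <= v ->
      lam ^+ 2 * gamma ^+ 2 / (8 * sigma ^+ 2)
        <= t k ^+ 2 / (2 * sigma ^+ 2 * v) ->
      (P [set w | (t k < `|\sum_m a k m * eps m w|)%R] <= q%:E)%E.
    move=> v_gt0 tk_gt0 av tv.
    have := subgaussian_sum_tail eps_indep eps_subg sigma2_gt0 v_gt0 av tk_gt0.
    move=> /le_trans; apply.
    by rewrite lee_fin ler_pM2l// ler_expR lerN2.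
  case: k le_q => [i|j] le_q.
    apply: (le_q mu^-1); rewrite ?invr_gt0//=.
      rewrite (pinv_row_norm Gu); apply: invmx_sym_diag_le => //.
        exact: gram_sym.
      by move=> c; exact: lambda_min_le_eigenvalue.
    (* With v = 1 / mu the factor [mu] cancels and the exponent is lam^2 / (8 sigma^2), at least the
       required one since gamma < 1. *)
    rewrite /t1 expr_div_n exprMn sqr_sqrtr; last exact: ltW.
    have -> : lam ^+ 2 / (2 ^+ 2 * mu) / (2 * sigma ^+ 2 / mu) =
        lam ^+ 2 / (8 * sigma ^+ 2).
      by field; rewrite -sqrf_eq0 !gt_eqF.
    by rewrite ler_wpM2r// invr_ge0 ltW.
  apply: (le_q 1); rewrite ?mulr_gt0//=.
    have := residual_norm Gu (col (enum_val j) B).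
    rewrite -[leRHS]l2norm_sqr B_unit expr1n; apply: le_trans.
    by rewrite /vdot ler_sum// => m _; rewrite expr2.
  (* With v = 1 the exponent has denominator 2 sigma^2 instead of 8 sigma^2. *)
  rewrite exprMn mulr1 ler_wpM2l//; first by rewrite mulr_ge0 ?sqr_ge0.
  rewrite lef_pV2 ?posrE//; last by rewrite mulr_gt0.
  by rewrite ler_pM2r// ler_nat.
have mgood : measurable good by exact: measurable_forall.
have Pgood := probability_forall_ge mE tail.
have prob_boundE : prob_bound = 1 - #|{: Ix}|%:R * q.
  by rewrite card_Ix /prob_bound /q mulrA [r%:R * 2]mulrC.
have mb i : measurable_fun setT (fun w => b w i 0).
  rewrite (_ : (fun w => _) = (fun w => (B *m theta) i 0 + eps i w)).
    exact: measurable_funD.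
  by apply/funext => w; rewrite b_def mxE [X in _ + X]mxE.
have mhat j : measurable_fun setT (fun w => theta_hat w j 0).
  exact: (measurable_lasso _ mb lam_ge0 B_rank theta_hat_opt).
have mhatS j : measurable_fun setT (fun w => thetaS_hat w j 0).
  exact: (measurable_lasso _ mb lam_ge0 (rank_cols Gu) thetaS_hat_opt).
have meq0 j : measurable [set w | theta_hat w j 0 = 0].
  rewrite -[[set _ | _]]setTI; exact: (mhat j measurableT [set 0]).
(* From here the argument is deterministic on [good]. *)
have goodE w : good w ->
  theta_hat w = extend (thetaS_hat w) /\ forall i, `|delta w i 0| <= t1 + lam * kappa.
  move=> gw; set phi := thetaS_hat w; pose e := \col_i eps i w.
  have bE : b w = B *m theta + e by rewrite b_def.
  have phi_opt : lasso_solution (B *m theta + e) A lam phi.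
    by rewrite -bE; exact: thetaS_hat_opt.
  pose c := lasso_corr A (B *m theta + e) phi.
  have c_le i : `|c i 0| <= lam by exact: lasso_corr_le.
  split; last first.
    move=> i; rewrite /delta (witness_error Gu e phi thS) mxE.
    rewrite (le_trans (ler_normD _ _))// lerD//.
      rewrite mxE; have := gw (inl i); rewrite /E/=; congr (_ <= _).
      by congr (`|_|); apply: eq_bigr => m _; rewrite !mxE.
    by rewrite mxE normrN; exact: opnorm_inf_mul.
  apply: (lasso_unique lam_ge0 B_rank (theta_hat_opt w)).
  rewrite bE; apply: lasso_extend => // j jS.
  have jSC : j \in ~: S by rewrite finset.in_setC.
  rewrite (witness_dual Gu e phi thS) (le_trans (ler_normD _ _))//.
  (* The share lam gamma pays for the noise and lam (1 - gamma) for the incoherence term. *)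
  have -> : lam = lam * gamma + lam * (1 - gamma) by rewrite -mulrDr addrC subrK mulr1.
  rewrite -(enum_rankK_in jSC jSC); set j' := enum_rank_in _ _.
  apply: lerD.
    have := gw (inr j'); rewrite /E/=; congr (_ <= _).
    by congr (`|_|); apply: eq_bigr => m _; rewrite [e _ _]mxE.
  pose M := (cols (~: S) B)^T *m A *m invmx G.
  apply: (@le_trans _ _ (lam * opnorm_inf M)); last by rewrite ler_wpM2l.
  apply: (le_trans _ (opnorm_inf_mul _ j' lam_ge0 c_le)).
  rewrite /M -!mulmxA le_eqVlt; apply/orP; left; apply/eqP.
  congr (`|_|); rewrite mxE [RHS]mxE; apply: eq_bigr => m _.
  by congr (_ * _); rewrite !mxE.
have delta_le w : (`|delta w| <= t1 + lam * kappa) <->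
    (forall i, `|delta w i 0| <= t1 + lam * kappa).
  have -> : `|delta w| = \big[Num.max/0]_ij `|delta w ij.1 ij.2|.
    exact: mx_normrE.
  split=> [/bigmax_leP[_ le_d] i|le_d].
    exact: (le_d (i, 0)).
  (* The maximum starts from 0, so the bound must also be shown nonnegative. *)
  apply/bigmax_leP; split=> [|[i l] _ /=]; last by rewrite ord1.
  by rewrite addr_ge0 ?mulr_ge0// ltW.
have good_supp w : good w -> vsupp (theta_hat w) \subset S.
  by move=> /goodE[-> _]; exact: vsupp_extend.
rewrite !prob_boundE; split.
  apply: le_trans Pgood _; apply: le_measure; [exact/mem_set|apply/mem_set|].
    apply: measurableI.
      (* Support conditions become finite conjunctions of conditions on measurable coordinates. *)
      rewrite (_ : [set w | _] = [set w | forall j, j \notin S -> theta_hat w j 0 = 0]).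
        pose F j := [set w | j \notin S -> theta_hat w j 0 = 0].
        apply: (measurable_forall (E := F)) => j; rewrite /F.
        have [jS|jS] := boolP (j \in S).
          by rewrite (_ : [set w | _] = setT)//; apply/seteqP; split.
        rewrite (_ : [set w | _] = [set w | theta_hat w j 0 = 0])//.
        by apply/seteqP; split=> w //=; exact.
      apply/seteqP; split=> w /=.
        move=> /fintype.subsetP sub j; apply: contraNeq => hj.
        by apply: sub; rewrite inE.
      move=> h0; apply/fintype.subsetP => j; rewrite inE.
      by apply: contraR => /h0 ->.
    rewrite (_ : [set w | _] = [set w | forall i, `|delta w i 0| <= t1 + lam * kappa]).
      pose F i := [set w | `|delta w i 0| <= t1 + lam * kappa].
      apply: (measurable_forall (E := F)) => i; rewrite -[F i]setTI.
      apply: measurable_fun_le => //; apply: measurableT_comp => //.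
      rewrite (_ : (fun w => _) = (fun w => thetaS_hat w i 0 - subvec S theta i 0)).
        exact: measurable_funB.
      by apply/funext => w; rewrite mxE [X in _ + X]mxE.
    by apply/seteqP; split=> w /delta_le.
  move=> w gw; split; first exact: good_supp.
  by apply/delta_le; case: (goodE w gw).
move=> theta_large.
apply: le_trans Pgood _; apply: le_measure; [exact/mem_set|apply/mem_set|].
  rewrite (_ : [set w | _] = [set w | forall j, (theta_hat w j 0 != 0) = (j \in S)]).
    pose F j := [set w | (theta_hat w j 0 != 0) = (j \in S)].
    apply: (measurable_forall (E := F)) => j; rewrite /F; case: (j \in S).
      rewrite (_ : [set w | _] = ~` [set w | theta_hat w j 0 = 0]).
        exact: measurableC.
      by apply/seteqP; split=> w /= /eqP.
    rewrite (_ : [set w | _] = [set w | theta_hat w j 0 = 0])//.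
    by apply/seteqP; split=> w /=; [move/negbFE/eqP|move=> ->; rewrite eqxx].
  apply/seteqP; split=> w /= => [<- j|h]; first by rewrite inE.
  by apply/finset.setP => j; rewrite inE h.
move=> w gw; have [hatE d_le] := goodE w gw.
apply/eqP; rewrite finset.eqEsubset good_supp//=; apply/fintype.subsetP => j jS.
rewrite inE hatE -(enum_rankK_in jS jS) extend_in.
(* A vanishing estimate at [j] in [S] would give an error of size |theta_j|, above the bound. *)
set i := enum_rank_in _ _; apply/eqP => phi0.
have := theta_large j jS; rewrite ltNge => /negP; apply.
have := d_le i; rewrite /delta mxE phi0 add0r mxE normrN mxE enum_rankK_in//.
by rewrite mulrDr mul1r.
Qed.
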